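(* $\Gamma_n$ is a finite state automaton accepting the language $L_n$. Moreover, any finite state automaton accepting the language $L_n$ has at least as many states as $\Gamma_n$.
   Context: $M=B_n^+$ is the positive braid monoid on $n$ strands, presented as a monoid by generators $\sigma_1,\ldots,\sigma_{n-1}$ and relations $\sigma_i\sigma_j=\sigma_j\sigma_i$ for $|i-j|>1$, $\sigma_i\sigma_j\sigma_i=\sigma_j\sigma_i\sigma_j$ for $|i-j|=1$. Let $\mathcal{A}=\{\sigma_1,\ldots,\sigma_{n-1}\}$, $\mathcal{A}^*$ the free monoid on $\mathcal{A}$, $\epsilon$ the empty word. The relations are homogeneous; for $\beta\in M$, $\omega(\beta)\in\mathcal{A}^*$ denotes the smallest word representing $\beta$ in the lexicographic order with $\sigma_1<\cdots<\sigma_{n-1}$ (the lex-representative), and $L_n=\{\omega(\beta)\mid\beta\in M\}$. $M$ is cancellative; for $a,b\in M$ write $a\preccurlyeq b$ if $ac=b$ for some $c\in M$. This is a lattice order; $a\vee b$ denotes the least common multiple, and $a\backslash b\in M$ is the unique element with $a(a\backslash b)=a\vee b$. For $w\in L_n$, $F_n(w)=\{\alpha\in M\mid w\,\omega(\alpha)\notin L_n\}$, and $F_n^{\min}(w)$ is the set of $\preccurlyeq$-minimal elements of $F_n(w)$. A finite state automaton is a quintuple $(\mathfrak{S},\mathcal{A},\mu,Y,S_0)$ with $\mathfrak{S}$ a finite set of states, $\mathcal{A}$ the alphabet, $\mu:\mathfrak{S}\times\mathcal{A}\to\mathfrak{S}$ the transition function, $Y\subseteq\mathfrak{S}$ the set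 of accepted states, $S_0\in\mathfrak{S}$ the initial state; $\mu$ is extended to $\mathfrak{S}\times\mathcal{A}^*\to\mathfrak{S}$ in the natural way, and the accepted language is $\{w\in\mathcal{A}^*\mid\mu(S_0,w)\in Y\}$. $\Gamma_n=(\mathfrak{S},\mathcal{A},\mu,Y,S_0)$ is defined by $\mathfrak{S}=\{S\subset M\mid S=F_n^{\min}(w)\text{ for some }w\in L_n\}\cup\{\mathcal{A}\}$ (where $\mathcal{A}$ is regarded as the set of atoms $\sigma_1,\ldots,\sigma_{n-1}$ of $M$), $S_0=\emptyset=F_n^{\min}(\epsilon)$, $Y=\mathfrak{S}\setminus\{\mathcal{A}\}$, and $$\mu(S,\sigma_i)=\begin{cases}\mathcal{A}&\text{if }\sigma_i\in S,\\ \min_{\preccurlyeq}\big(\{\sigma_1,\ldots,\sigma_{i-2},\sigma_{i-1}\sigma_i\}\cup\{\sigma_i\backslash\beta\mid\beta\in S\}\big)&\text{otherwise,}\end{cases}$$ where $\min_\preccurlyeq$ denotes the set of $\preccurlyeq$-minimal elements, and words involving indices less than $1$ are ignored.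
   Formalization: Stated for n ≥ 2, with minimality only for n ≥ 3: for n = 1, 𝒜 = ∅ = F_1^min(ε), so Γ_1 accepts nothing while L_1 = {ε}; for n = 2, L_2 = 𝒜* is accepted by a one-state automaton but Γ_2 has two states. *)

(* Defs.v *)
From HB Require Import structures.
From mathcomp Require Import all_boot all_order generic_quotient.
From mathcomp Require Import boolp classical_sets functions cardinality.

Set Implicit Arguments.
Unset Strict Implicit.
Unset Printing Implicit Defensive.

Import Order.TTheory.

Local Open Scope quotient_scope.
Local Open Scope classical_set_scope.
Local Open Scope group_scope.

(* The generators sigma_1, ..., sigma_(n-1) are indexed by 'I_n.-1, which
   counts from 0: the ordinal i stands for sigma_(i+1). *)
Definition word (n : nat) := seq 'I_n.-1.

Inductive braid_congr (n : nat) : word n -> word n -> Prop :=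
| BraidComm (i j : 'I_n.-1) of (i.+1 < j) || (j.+1 < i) :
    braid_congr [:: i; j] [:: j; i]
| BraidBraid (i j : 'I_n.-1) of (i.+1 == j) || (j.+1 == i) :
    braid_congr [:: i; j; i] [:: j; i; j]
| BraidRefl u : braid_congr u u
| BraidSym u v of braid_congr u v : braid_congr v u
| BraidTrans u v w of braid_congr u v & braid_congr v w : braid_congr u w
| BraidCat u u' v v' of braid_congr u u' & braid_congr v v' :
    braid_congr (u ++ v) (u' ++ v').

Section BraidMonoid.
Variable n : nat.
Implicit Types u v w : word n.

Definition braid_congrb : rel (word n) := fun u v => `[< braid_congr u v >].

Lemma braid_congrb_equiv : equiv_class_of braid_congrb.
Proof.
split=> [u|u v|v u w].
- exact/asboolP/BraidRefl.
- by apply/asboolP/asboolP; apply: BraidSym.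
- by move=> /asboolP uv /asboolP vw; apply/asboolP/(BraidTrans uv vw).
Qed.

Canonical braid_congr_rel := EquivRelPack braid_congrb_equiv.

Definition braid : Type := {eq_quot braid_congr_rel}.

HB.instance Definition _ := Choice.on braid.
HB.instance Definition _ := Quotient.on braid.

Definition braid_of_word (w : word n) : braid := (\pi_braid w)%qT.

Lemma braid_of_wordE u v :
  braid_of_word u = braid_of_word v <-> braid_congr u v.
Proof. by split=> [/eqmodP/asboolP|uv] //; apply/eqmodP/asboolP. Qed.

Lemma braid_wordP (b : braid) : exists w, braid_of_word w = b.
Proof. by exists (repr b); rewrite /braid_of_word reprK. Qed.

Definition braid_mul (a b : braid) : braid :=
  braid_of_word ((repr a : word n) ++ (repr b : word n)).

Lemma braid_mulE u v :
  braid_mul (braid_of_word u) (braid_of_word v) = braid_of_word (u ++ v).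
Proof.
by apply/braid_of_wordE/BraidCat; apply/braid_of_wordE;
   rewrite /braid_of_word reprK.
Qed.

Lemma braid_mulA : associative braid_mul.
Proof.
move=> a b c; have [u <-] := braid_wordP a; have [v <-] := braid_wordP b.
by have [w <-] := braid_wordP c; rewrite !braid_mulE catA.
Qed.

Lemma braid_mul1g : left_id (braid_of_word [::]) braid_mul.
Proof. by move=> a; have [u <-] := braid_wordP a; rewrite braid_mulE. Qed.

Lemma braid_mulg1 : right_id (braid_of_word [::]) braid_mul.
Proof. by move=> a; have [u <-] := braid_wordP a; rewrite braid_mulE cats0. Qed.

HB.instance Definition _ :=
  isMonoid.Build braid braid_mulA braid_mul1g braid_mulg1.

Definition sigma (i : 'I_n.-1) : braid := braid_of_word [:: i].

Definition atoms : set braid := range sigma.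

Lemma braid_congr_size u v : braid_congr u v -> size u = size v.
Proof.
by elim=> // {u v} [u v w _ -> _ ->|u u' v v' _ + _ +] //; rewrite !size_cat => -> ->.
Qed.

Definition is_lexrep (b : braid) (w : word n) : Prop :=
  braid_of_word w = b /\
  forall v, braid_of_word v = b ->
    ((w : seqlexi 'I_n.-1) <= (v : seqlexi 'I_n.-1))%O.

Lemma lexrep_exists (b : braid) : exists w, is_lexrep b w.
Proof.
have [w0 w0b] := braid_wordP b.
pose P := fun t : (size w0).-tuple 'I_n.-1 =>
  `[< braid_of_word (t : word n) = b >].
have P0 : P (in_tuple w0) by apply/asboolP.
have [t /asboolP tb tmin] := @arg_minP _ (seqlexi 'I_n.-1) _ (in_tuple w0) P
  (fun t => (t : word n)) P0.
exists t; split=> // v vb.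
have sv : size v == size w0.
  by apply/eqP/braid_congr_size/braid_of_wordE; rewrite vb w0b.
by apply: (tmin (Tuple sv)); apply/asboolP.
Qed.

Definition omega (b : braid) : word n := sval (cid (lexrep_exists b)).

Definition lex_language : set (word n) := range omega.

Definition prec (a b : braid) : Prop := exists c, a * c = b.

Definition is_join (a b m : braid) : Prop :=
  [/\ prec a m, prec b m &
      forall m', prec a m' -> prec b m' -> prec m m'].

(* [join a b] is a \/ b and [resid a b] is a\b.  The defaults of [xget] play
   no role, since least common multiples exist in the braid monoid; moreover
   they are unique, and so is [resid a b], by cancellativity. *)
Definition join (a b : braid) : braid := xget 1 (is_join a b).

Definition resid (a b : braid) : braid :=
  xget 1 [set c | a * c = join a b].

Definition minimal (S : set braid) : set braid :=
  [set a | S a /\ forall b, S b -> prec b a -> b = a].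

Definition forbidden (w : word n) : set braid :=
  [set a | ~ lex_language (w ++ omega a)].

Definition Fmin (w : word n) : set braid := minimal (forbidden w).

End BraidMonoid.

Arguments atoms n : clear implicits.
Arguments lex_language n : clear implicits.

(* The states form a subset of an ambient type, so that the set of states of
   Gamma is literally a set of subsets of the braid monoid.  The transition
   function is total on the ambient type; only its values on the states
   matter. *)
Record automaton (A T : Type) := Automaton {
  states : set T;
  trans : T -> A -> T;
  accepted : set T;
  init : T
}.

Definition is_finite_automaton (A T : Type) (G : automaton A T) : Prop :=
  [/\ finite_set (states G),
      forall s a, states G s -> states G (trans G s a),
      accepted G `<=` states G &
      states G (init G)].

Definition accepted_language (A T : Type) (G : automaton A T) : set (seq A) :=
  [set w | accepted G (foldl (trans G) (init G) w)].

Section Gamma.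
Variable n : nat.

Definition Gamma_states : set (set (braid n)) :=
  [set S | exists2 w, lex_language n w & S = Fmin w] `|` [set atoms n].

(* sigma_1, ..., sigma_(i-2) are the [sigma j] with j.+1 < i, and
   sigma_(i-1) sigma_i is present only when i is not the first generator. *)
Definition Gamma_trans (S : set (braid n)) (i : 'I_n.-1) : set (braid n) :=
  if `[< S (sigma i) >] then atoms n
  else minimal ([set sigma j | j in [set j : 'I_n.-1 | j.+1 < i]]
            `|` [set sigma j * sigma i | j in [set j : 'I_n.-1 | j.+1 = i]]
            `|` [set resid (sigma i) b | b in S]).

(* For n = 1 the state [atoms] is empty, hence equal to [Fmin [::]], and Gamma
   accepts no word; for n = 2 no word reaches [atoms], and Gamma, with two
   states, is not minimal. *)
Definition Gamma : automaton 'I_n.-1 (set (braid n)) :=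
  {| states := Gamma_states;
     trans := Gamma_trans;
     accepted := Gamma_states `\ atoms n;
     init := set0 |}.

End Gamma.

Lemma omega_spec (n : nat) (b : braid n) : is_lexrep b (omega b).
Proof. exact: svalP (cid (lexrep_exists b)). Qed.

Lemma Fmin_nil (n : nat) : Fmin ([::] : word n) = set0.
Proof. by apply/seteqP; split=> a // [[]]; exists a. Qed.

(* Main.v *)
(* Garside's lemma (if sigma_i a = sigma_j b then a and b factor through the
   least common multiple of sigma_i and sigma_j) gives left cancellation and
   the existence of the lcm of two elements having a common multiple. As the
   atoms have a common multiple, they have a lcm D, and the set of divisors of D
   is finite and stable under sigma_i \ _ .
   An element a is forbidden after w exactly when w = u sigma_i w' with
   sigma_j dividing sigma_i w' a for some j < i. This condition is recursive in
   w, and yields the transition function; it also shows that the minimal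
   forbidden elements divide D, whence the finiteness. The sink is never of the
   form Fmin w because D is square-free: the last letter of a word of the
   language can always be repeated. Minimality is the Myhill-Nerode argument:
   distinct states are separated by a word omega a. *)
Require Import Defs.
From mathcomp Require Import all_boot all_order.
From mathcomp Require Import boolp classical_sets functions cardinality.
From mathcomp Require Import zify.

Set Implicit Arguments.
Unset Strict Implicit.
Unset Printing Implicit Defensive.

(** * Garside's lemma and left cancellation *)

Section Garside.
Local Open Scope classical_set_scope.
Local Open Scope group_scope.
Variable n : nat.
Implicit Types (i j k l : 'I_n.-1) (a b c m : braid n) (u v w : word n).

Definition blen a : nat := size (repr a : word n).

Lemma blenE w : blen (braid_of_word w) = size w.
Proof.
by apply: braid_congr_size; apply/braid_of_wordE; rewrite /braid_of_word reprK.
Qed.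

Lemma braid_of_cons i w : braid_of_word (i :: w) = sigma i * braid_of_word w.
Proof. by rewrite [RHS]braid_mulE. Qed.

Lemma braid_of_cat u v :
  braid_of_word (u ++ v) = braid_of_word u * braid_of_word v.
Proof. by rewrite [RHS]braid_mulE. Qed.

Lemma blenM a b : blen (a * b) = (blen a + blen b)%N.
Proof.
have [u <-] := braid_wordP a; have [v <-] := braid_wordP b.
by rewrite -braid_of_cat !blenE size_cat.
Qed.

Lemma blen_sigma i : blen (sigma i) = 1%N.
Proof. exact: blenE. Qed.

Lemma blen1 : blen 1 = 0%N.
Proof. exact: blenE. Qed.

Lemma blen_eq0 a : blen a = 0%N -> a = 1.
Proof. by have [u <-] := braid_wordP a; rewrite blenE => /size0nil ->. Qed.

Variant braid_spec : braid n -> Prop :=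
  | BraidOne : braid_spec 1
  | BraidSigma i a : braid_spec (sigma i * a).

Lemma braidP a : braid_spec a.
Proof.
have [[|i u] <-] := braid_wordP a; first exact: BraidOne.
by rewrite braid_of_cons; apply: BraidSigma.
Qed.

Definition adjacent i j := (i.+1 == j) || (j.+1 == i).

Lemma adjacentC i j : adjacent i j = adjacent j i.
Proof. exact: orbC. Qed.

Lemma adjacent_trans i k j :
  adjacent i k -> adjacent k j -> i != j -> ~~ adjacent i j.
Proof.
rewrite /adjacent => ik kj /eqP ij.
by have : (i : nat) <> j by [move/val_inj]; lia.
Qed.

Lemma sigma_comm i j : ~~ adjacent i j -> sigma i * sigma j = sigma j * sigma i.
Proof.
rewrite /adjacent => nij; have [->//|/eqP neq] := eqVneq i j.
rewrite [LHS]braid_mulE [RHS]braid_mulE; apply/braid_of_wordE/BraidComm.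
by have : (i : nat) <> j by [move/val_inj]; lia.
Qed.

Lemma sigma_braid i j : adjacent i j ->
  sigma i * (sigma j * sigma i) = sigma j * (sigma i * sigma j).
Proof.
move=> ij; have E k l :
    sigma k * (sigma l * sigma k) = braid_of_word [:: k; l; k].
  by rewrite 2!braid_of_cons.
by rewrite !E; apply/braid_of_wordE/BraidBraid.
Qed.

Lemma sigma_commA i j a : ~~ adjacent i j ->
  sigma i * (sigma j * a) = sigma j * (sigma i * a).
Proof. by move=> /sigma_comm ij; rewrite !mulgA ij. Qed.

Lemma sigma_braidA i j a : adjacent i j ->
  sigma i * (sigma j * (sigma i * a)) = sigma j * (sigma i * (sigma j * a)).
Proof.
by move=> /sigma_braid ij; have := congr1 (fun x => x * a) ij; rewrite -!mulgA.
Qed.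

(* [compl i j] is sigma_i \ sigma_j. *)
Definition compl i j : braid n :=
  if i == j then 1 else if adjacent i j then sigma j * sigma i else sigma j.

Lemma complxx i : compl i i = 1. Proof. by rewrite /compl eqxx. Qed.

Lemma sigma_compl i j : sigma i * compl i j = sigma j * compl j i.
Proof.
rewrite /compl (eq_sym j) (adjacentC j); case: eqVneq => [->//|_].
by case: ifPn => [/sigma_braid|/sigma_comm].
Qed.

(** The conclusion of Garside's lemma for sigma_i a = sigma_j b: both sides are sigma_i
    ([compl i j]) c for a common [c]. *)
Definition resolved i a j b := exists c, a = compl i j * c /\ b = compl j i * c.

Lemma resolvedC i a j b : resolved i a j b -> resolved j b i a.
Proof. by case=> c [-> ->]; exists c. Qed.

Lemma resolved_comm i j a b : i != j -> ~~ adjacent i j ->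
  resolved i a j b -> exists c, a = sigma j * c /\ b = sigma i * c.
Proof.
move=> ij nij [c]; rewrite /compl (adjacentC j) !(negPf nij) (eq_sym j).
by rewrite !(negPf ij); exists c.
Qed.

Lemma resolved_adj i j a b : i != j -> adjacent i j -> resolved i a j b ->
  exists c, a = sigma j * (sigma i * c) /\ b = sigma i * (sigma j * c).
Proof.
move=> ij nij [c]; rewrite /compl (adjacentC j) !nij (eq_sym j) !(negPf ij).
by rewrite -!mulgA; exists c.
Qed.

(** * Garside's lemma *)

Lemma blen_sigma_mul i j a b :
  sigma i * a = sigma j * b -> blen a = blen b.
Proof. by move=> /(congr1 blen); rewrite !blenM !blen_sigma => -[]. Qed.

(** The hard step is to chain sigma_i a = sigma_k c = sigma_j b. The two factorisations of [c] are
    compared after stripping a letter, where induction applies; the cases follow the adjacencies of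
    [i], [k] and [j]. *)
Lemma resolved_trans N :
  (forall i j a b,
     blen a < N -> sigma i * a = sigma j * b -> resolved i a j b) ->
  forall i k j a c b, blen c <= N ->
  resolved i a k c -> resolved k c j b -> resolved i a j b.
Proof.
move=> IH.
(* [IHe], [IHc] and [IHb] specialise the induction hypothesis to equal, commuting and adjacent
   letters; [Rc] and [Rb] go back to [resolved]. *)
have IHe i a b : blen a < N -> sigma i * a = sigma i * b -> a = b.
  by move=> aN /(IH _ _ _ _ aN)[x]; rewrite complxx !mul1g => -[-> ->].
have IHc i j a b : i != j -> ~~ adjacent i j -> blen a < N ->
    sigma i * a = sigma j * b -> exists c, a = sigma j * c /\ b = sigma i * c.
  by move=> ij nij aN /IH-/(_ aN)/(resolved_comm ij nij).
have IHb i j a b : i != j -> adjacent i j -> blen a < N ->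
    sigma i * a = sigma j * b ->
    exists c, a = sigma j * (sigma i * c) /\ b = sigma i * (sigma j * c).
  by move=> ij nij aN /IH-/(_ aN)/(resolved_adj ij nij).
have Rc i j x : i != j -> ~~ adjacent i j ->
    resolved i (sigma j * x) j (sigma i * x).
  move=> ij nij; exists x; rewrite /compl (adjacentC j) (eq_sym j).
  by rewrite !(negPf nij) !(negPf ij).
have Rb i j x : i != j -> adjacent i j ->
    resolved i (sigma j * (sigma i * x)) j (sigma i * (sigma j * x)).
  move=> ij nij; exists x; rewrite /compl (adjacentC j) (eq_sym j).
  by rewrite !nij !(negPf ij) -!mulgA.
(* The remaining case, [adjacent k j] without [adjacent i k], is a mirror
   image. *)
have main i k j a c b : i != k -> k != j -> i != j ->
    adjacent i k || ~~ adjacent k j -> blen c <= N ->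
    resolved i a k c -> resolved k c j b -> resolved i a j b.
  move=> ik kj ij; case: (boolP (adjacent i k)) => /= aik; last first.
    (* Here [k] commutes with both letters: resolve c = sigma_i z = sigma_j w, then move sigma_k
       inside. *)
    move=> akj cN /(resolved_comm ik aik)[z [-> cz]].
    move=> /(resolved_comm kj akj)[w []]; rewrite cz => zw ->.
    move: cN; rewrite cz blenM blen_sigma add1n => zN.
    have ck := @sigma_commA k j ^~ akj.
    have ci x : sigma k * (sigma i * x) = sigma i * (sigma k * x).
      by apply: sigma_commA; rewrite adjacentC.
    case: (boolP (adjacent i j)) => aij.
      have [x [-> ->]] := IHb _ _ _ _ ij aij zN zw.
      by rewrite !(ck, ci); apply: Rb.
    have [x [-> ->]] := IHc _ _ _ _ ij aij zN zw.
    by rewrite !(ck, ci); apply: Rc.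
  move=> _ cN /(resolved_adj ik aik)[z [-> cz]].
  case: (boolP (adjacent k j)) => akj.
    (* Now [k] lies between [i] and [j], which commute. Repeated induction leads to one braid [r],
       from which a = sigma_j u and b = sigma_i u. *)
    move=> /(resolved_adj kj akj)[w []]; rewrite cz => zw ->.
    have nij := adjacent_trans aik akj ij.
    move: cN; rewrite cz !blenM !blen_sigma => cN.
    have zN : blen (sigma k * z) < N by rewrite blenM blen_sigma; lia.
    have [x [zx wx]] := IHc _ _ _ _ ij nij zN zw.
    have wz : blen w = blen z.
      by have := blen_sigma_mul zw; rewrite !blenM !blen_sigma => -[].
    have xz : blen x = blen z by rewrite (blen_sigma_mul zx).
    have jk : j != k by rewrite eq_sym.
    have ki : k != i by rewrite eq_sym.
    have akj' : adjacent j k by rewrite adjacentC.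
    have aik' : adjacent k i by rewrite adjacentC.
    have [|p [zp xp]] := IHb _ _ _ _ kj akj _ zx; first by lia.
    have [|q [wq xq]] := IHb _ _ _ _ ki aik' _ wx; first by lia.
    have px : (blen (sigma j * p)).+1 = blen x.
      by have := congr1 blen xp; rewrite !blenM !blen_sigma; lia.
    have aji : ~~ adjacent j i by rewrite adjacentC.
    have ji : j != i by rewrite eq_sym.
    have [||r [pr qr]] := IHc _ _ p q ji aji.
    - by move: px; rewrite blenM blen_sigma; lia.
    - by apply: IHe (etrans (esym xp) xq); lia.
    rewrite zp wq pr qr.
    set u := sigma k * (sigma j * (sigma i * (sigma k * r))).
    have -> : sigma k * (sigma i * (sigma j * (sigma k * (sigma i * r)))) =
              sigma j * u.
      by rewrite (sigma_commA _ nij) (sigma_braidA _ aik) (sigma_braidA _ akj).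
    have -> : sigma k * (sigma j * (sigma i * (sigma k * (sigma j * r)))) =
              sigma i * u.
      by rewrite (sigma_commA _ aji) (sigma_braidA _ akj') (sigma_braidA _ aik')
                 /u (sigma_commA _ aji).
    exact: Rc.
  move=> /(resolved_comm kj akj)[w []]; rewrite cz => zw ->.
  have ck := @sigma_commA k j ^~ akj.
  have wz : blen w = (blen z).+1.
    by have := blen_sigma_mul zw; rewrite !blenM !blen_sigma => <-.
  move: cN; rewrite cz !blenM !blen_sigma !add1n => cN.
  have zkN : blen (sigma k * z) < N by rewrite blenM blen_sigma.
  case: (boolP (adjacent i j)) => aij.
    have [x [zx ->]] := IHb _ _ _ _ ij aij zkN zw.
    have xz : (blen x).+1 = blen z.
      by have := blen_sigma_mul zx; rewrite !blenM !blen_sigma => ->.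
    have [|y [-> xy]] := IHc _ _ _ _ kj akj _ zx; first by lia.
    have [|u [-> ->]] := IHb _ _ _ _ ik aik _ xy; first by lia.
    set v := sigma k * (sigma i * (sigma j * u)).
    have -> : sigma k * (sigma i * (sigma j * (sigma i * (sigma k * u)))) =
              sigma j * (sigma i * v).
      by rewrite (sigma_braidA _ aij) ck -(ck u) -(sigma_braidA _ aik).
    have -> : sigma k * (sigma i * (sigma j * (sigma k * (sigma i * u)))) =
              sigma i * (sigma j * v).
      by rewrite -(ck (_ * u)) -(sigma_braidA _ aik) (sigma_braidA _ aij) ck.
    exact: Rb.
  have [x [zx ->]] := IHc _ _ _ _ ij aij zkN zw.
  have [|y [-> ->]] := IHc _ _ _ _ kj akj _ zx; first by lia.
  rewrite (sigma_commA _ aij) ck -(sigma_braidA _ aik).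
  exact: Rc.
move=> i k j a c b cN.
have [->|ik] := eqVneq i k.
  by case=> x [-> ->]; rewrite complxx mul1g.
have [->|kj] := eqVneq k j.
  by move=> ac [x [cx ->]]; rewrite complxx mul1g -(mul1g x) -(complxx j) -cx.
(* If i = j, both factorisations of [c] start with [compl k i], which [IHe] cancels letter by
   letter. *)
have [<-|ij] := eqVneq i j.
  case=> x [-> cx] [y [cy ->]]; suff -> : x = y.
    by exists (compl i k * y); rewrite complxx mul1g.
  move: cN cy; rewrite {}cx /compl eq_sym (negPf ik).
  case: ifP => _; rewrite !blenM !blen_sigma => xN; last by apply: IHe.
  rewrite -!mulgA => /IHe-/(_ ltac:(rewrite blenM blen_sigma; lia)).
  by apply: IHe; lia.
case: (boolP (adjacent i k || ~~ adjacent k j)) => [|/norP[_ /negPn akj]].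
  by move=> acyc; apply: main.
move=> ac cb; apply/resolvedC/(main _ k _ _ c) => //; rewrite 1?eq_sym //.
- by rewrite adjacentC akj.
- exact: resolvedC.
- exact: resolvedC.
Qed.

(** Induction on the derivation of the congruence, with [resolved_trans] for transitivity. *)
Lemma braid_congr_resolved N :
  (forall i j a b,
     blen a < N -> sigma i * a = sigma j * b -> resolved i a j b) ->
  forall u v, braid_congr u v -> forall i j x y, size x <= N ->
  u = i :: x -> v = j :: y -> resolved i (braid_of_word x) j (braid_of_word y).
Proof.
move=> IH u v; elim=> {u v}.
- move=> i j ij _ _ _ _ _ [<- <-] [<- <-]; exists 1; rewrite /compl eq_sym.
  case: eqVneq => [E|_]; first by move: ij; rewrite E; lia.
  suff /negPf nij : ~~ adjacent i j by rewrite (adjacentC j) nij !mulg1.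
  by rewrite /adjacent; lia.
- move=> i j ij _ _ _ _ _ [<- <-] [<- <-]; exists 1; rewrite /compl eq_sym.
  case: eqVneq => [E|_]; first by move: ij; rewrite E; lia.
  have aij : adjacent i j by [].
  by rewrite (adjacentC j) aij !mulg1 !braid_of_cons !mulg1.
- move=> u i j x y _ -> [<- <-].
  by exists (braid_of_word x); rewrite complxx mul1g.
- move=> u v uv IHuv i j x y xN vE uE; apply/resolvedC/IHuv => //.
  by have := braid_congr_size uv; rewrite uE vE /= => -[->].
- move=> u v w uv IHuv vw IHvw i j x y xN uE wE.
  have [[|k z] vE] : exists z, v = z by exists v.
    by have := braid_congr_size uv; rewrite uE vE.
  have zN : size z <= N.
    by have := braid_congr_size uv; rewrite uE vE /= => -[<-].
  apply: (resolved_trans IH (k := k) (c := braid_of_word z)).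
  - by rewrite blenE.
  - exact: IHuv.
  - exact: IHvw.
- move=> u u' v v' uu' IHu vv' IHv i j x y xN; have := braid_congr_size uu'.
  (* Either both left blocks are empty, or both first letters lie in them and the common factor
     absorbs the right block. *)
  case: u u' uu' IHu => [|k u] [|l u'] // uu' IHu _; first exact: IHv.
  rewrite !cat_cons => -[ki ux] [lj uy].
  rewrite -{}ux in xN *; rewrite -{}uy -{}ki -{}lj.
  rewrite size_cat in xN.
  have [|c [uE u'E]] := IHu k l u u' _ erefl erefl.
    by apply: leq_trans xN; rewrite leq_addr.
  exists (c * braid_of_word v); rewrite !braid_of_cat uE u'E !mulgA.
  by split=> //; congr (_ * _); apply/esym/braid_of_wordE.
Qed.

(** Garside's lemma, by induction on the common length of [a] and [b]. *)
Lemma sigma_mul_eq i j a b : sigma i * a = sigma j * b -> resolved i a j b.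
Proof.
have [N] := ubnP (blen a); elim: N => // N IH in i j a b *; rewrite ltnS.
have [u <-] := braid_wordP a; have [v <-] := braid_wordP b.
rewrite blenE -!braid_of_cons => uN /braid_of_wordE uv.
exact: (@braid_congr_resolved N _ _ _ uv).
Qed.

Lemma sigma_inj_mul i a b : sigma i * a = sigma i * b -> a = b.
Proof. by move=> /sigma_mul_eq[c]; rewrite complxx mul1g => -[-> ->]. Qed.

Lemma braid_mulI a b c : a * b = a * c -> b = c.
Proof.
have [w <-] := braid_wordP a; elim: w => [|i w IH] in b c *.
  by rewrite !mul1g.
by rewrite braid_of_cons -!mulgA => /sigma_inj_mul/IH.
Qed.

End Garside.

(** * Least common multiples and the Garside element *)

Section Lcm.
Local Open Scope classical_set_scope.
Local Open Scope group_scope.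
Variable n : nat.
Implicit Types (i j : 'I_n.-1) (k : nat) (a b c m : braid n) (u v w : word n).

(** * Divisibility, lcms and residues *)

Lemma prec_refl a : prec a a.
Proof. by exists 1; rewrite mulg1. Qed.

Lemma prec_mulr a b : prec a (a * b).
Proof. by exists b. Qed.

Lemma prec_trans b a c : prec a b -> prec b c -> prec a c.
Proof. by move=> [x <-] [y <-]; exists (x * y); rewrite mulgA. Qed.

Lemma prec_mul2l c a b : prec (c * a) (c * b) <-> prec a b.
Proof.
split=> [[x]|[x <-]]; first by rewrite -mulgA => /braid_mulI; exists x.
by exists x; rewrite mulgA.
Qed.

Lemma prec_blen a b : prec a b -> blen a <= blen b.
Proof. by move=> [x <-]; rewrite blenM leq_addr. Qed.

Lemma prec_eq a b : prec a b -> blen b <= blen a -> a = b.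
Proof.
move=> [x <-]; rewrite blenM => xa; rewrite (@blen_eq0 _ x) ?mulg1 //; lia.
Qed.

Lemma prec_antisym a b : prec a b -> prec b a -> a = b.
Proof. by move=> ab /prec_blen; apply: prec_eq. Qed.

Lemma prec_sigma a i : prec a (sigma i) -> a = 1 \/ a = sigma i.
Proof.
move=> ai; have := prec_blen ai; rewrite blen_sigma.
case E : (blen a) => [|l] al; first by left; apply: blen_eq0.
by right; apply: prec_eq ai _; rewrite blen_sigma E.
Qed.

Lemma prec_sigma_compl i j m :
  prec (sigma j) (sigma i * m) <-> prec (compl i j) m.
Proof.
split=> [[x /esym/sigma_mul_eq[z [-> _]]]|[x <-]]; first exact: prec_mulr.
by rewrite mulgA sigma_compl -mulgA; apply: prec_mulr.
Qed.

Lemma sigma_inj : injective (@sigma n).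
Proof.
move=> i j ij; apply/eqP; apply: contraT => nij.
have : prec (sigma j) (sigma i * 1) by rewrite mulg1 ij; apply: prec_refl.
move=> /prec_sigma_compl/prec_blen; rewrite blen1 /compl (negPf nij).
by case: ifP; rewrite ?blenM !blen_sigma.
Qed.

(** Induction on the length of [m]. For a = sigma_i a' and b = sigma_j b', every common multiple
    lies above sigma_i [compl i j], and the lcm is assembled from three shorter ones. *)
Lemma ex_lcm a b m : prec a m -> prec b m -> exists c, is_join a b c.
Proof.
have [N] := ubnP (blen m); elim: N => // N IH in a b m *; rewrite ltnS => mN.
case: (braidP a) => [_ _|i a' [z az]].
  exists b; split=> [||m' _] //; last exact: prec_refl.
  by exists b; rewrite mul1g.
case: (braidP b) => [_|j b' [z' bz]].
  exists (sigma i * a'); split=> //; first exact: prec_refl.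
  by exists (sigma i * a'); rewrite mul1g.
have resolve x x' : sigma i * a' * x = sigma j * b' * x' ->
    exists y, a' * x = compl i j * y /\ b' * x' = compl j i * y.
  by rewrite -!mulgA => /sigma_mul_eq.
have [y [az' bz']] := resolve z z' (etrans az (esym bz)).
have azm : (blen (a' * z)).+1 = blen m.
  by rewrite -az -mulgA [RHS]blenM blen_sigma.
have bzm : (blen (b' * z')).+1 = blen m.
  by rewrite -bz -mulgA [RHS]blenM blen_sigma.
(* The shorter lcms are those of a' and [compl i j], of b' and [compl j i], and of the cofactors
   [p1] and [q1]. *)
have [|||p [ap [p1 pE] pmin]] := IH a' (compl i j) (a' * z).
- by rewrite azm.
- exact: prec_mulr.
- by rewrite az'; apply: prec_mulr.
rewrite -{}pE in ap pmin.
have [|||q [bq [q1 qE] qmin]] := IH b' (compl j i) (b' * z').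
- by rewrite bzm.
- exact: prec_mulr.
- by rewrite bz'; apply: prec_mulr.
rewrite -{}qE in bq qmin.
have up x x' t : a' * x = compl i j * t -> b' * x' = compl j i * t ->
    prec p1 t /\ prec q1 t.
  move=> xt xt'; split.
    apply/(prec_mul2l (compl i j))/pmin; last exact: prec_mulr.
    by rewrite -xt; apply: prec_mulr.
  apply/(prec_mul2l (compl j i))/qmin; last exact: prec_mulr.
  by rewrite -xt'; apply: prec_mulr.
have [p1y q1y] := up _ _ _ az' bz'.
have [|r [p1r q1r rmin]] := IH p1 q1 y _ p1y q1y.
  by move: mN; rewrite -azm az' blenM; lia.
exists (sigma i * (compl i j * r)); split=> [||m' [x ax] [x' bx]].
- by apply/prec_mul2l; apply: prec_trans ap _; apply/prec_mul2l.
- rewrite mulgA sigma_compl -mulgA; apply/prec_mul2l.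
  by apply: prec_trans bq _; apply/prec_mul2l.
have [t [xt xt']] := resolve x x' (etrans ax (esym bx)).
have [p1t q1t] := up _ _ _ xt xt'.
rewrite -ax -mulgA; apply/prec_mul2l; rewrite xt; apply/prec_mul2l.
exact: rmin.
Qed.

Lemma join_is_join a b m : prec a m -> prec b m -> is_join a b (join a b).
Proof.
by move=> am bm; apply: (@xgetPex _ 1 (is_join a b)); apply: ex_lcm am bm.
Qed.

Lemma residE a b m : prec a m -> prec b m -> a * resid a b = join a b.
Proof.
move=> am bm; have [ab _ _] := join_is_join am bm.
exact: (@xgetPex _ 1 [set c | a * c = join a b] ab).
Qed.

(** Residuation by [a] is adjoint to multiplication by [a]. The common multiple [m] ensures that
    [join] and [resid] are not default values. *)
Lemma prec_resid a b m c : prec a m -> prec b m ->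
  prec (resid a b) c <-> prec b (a * c).
Proof.
move=> am bm; rewrite -(prec_mul2l a) (residE am bm).
have [aj bj jmin] := join_is_join am bm; split; first exact: prec_trans.
by move=> bac; apply: jmin => //; apply: prec_mulr.
Qed.

(* For [k < n.-1], [gen k] is the generator sigma_(k+1); larger [k] give 1. *)
Definition gen (k : nat) : braid n := oapp (@sigma n) 1 (insub k).

Lemma gen_ord i : gen i = sigma i.
Proof. by rewrite /gen valK. Qed.

Lemma gen_comm (i j : nat) : i.+1 < j -> gen i * gen j = gen j * gen i.
Proof.
rewrite /gen; case: insubP => [x _ <-|_]; last by rewrite mul1g mulg1.
case: insubP => [y _ <-|_] /= xy; last by rewrite mul1g mulg1.
by apply: sigma_comm; rewrite /adjacent; lia.
Qed.

Lemma gen_braid k : k.+1 < n.-1 ->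
  gen k.+1 * (gen k * gen k.+1) = gen k * (gen k.+1 * gen k).
Proof.
move=> kn; have -> : gen k = sigma (Ordinal (ltnW kn)) by rewrite -gen_ord.
have -> : gen k.+1 = sigma (Ordinal kn) by rewrite -gen_ord.
by apply: sigma_braid; rewrite /adjacent /= eqxx orbT.
Qed.

Fixpoint gen_prod k : braid n := if k is k'.+1 then gen_prod k' * gen k' else 1.

(** The half twist on k + 1 strands: (sigma_1 ... sigma_k)(sigma_1 ... sigma_(k-1)) ... sigma_1. *)
Fixpoint half_twist k : braid n :=
  if k is k'.+1 then gen_prod k * half_twist k' else 1.

Lemma gen_prodS k : gen_prod k.+1 = gen_prod k * gen k.
Proof. by []. Qed.

Lemma gen_gen_prod (j k : nat) :
  k < j -> gen j * gen_prod k = gen_prod k * gen j.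
Proof.
elim: k => [|k IH] kj; first by rewrite mul1g mulg1.
by rewrite gen_prodS mulgA IH 1?ltnW // -!mulgA (gen_comm kj).
Qed.

Lemma gen_prod_shift (i k : nat) : i.+1 < k -> k <= n.-1 ->
  gen_prod k * gen i = gen i.+1 * gen_prod k.
Proof.
elim: k => // k IH; rewrite ltnS leq_eqVlt => /orP[/eqP<- kn|ik kn].
  rewrite 2!gen_prodS -!mulgA -gen_braid // [LHS]mulgA.
  by rewrite -gen_gen_prod // -!mulgA.
by rewrite gen_prodS mulgA -(IH ik (ltnW kn)) -!mulgA (gen_comm ik).
Qed.

(** The first factor starts with [gen 0]; the other generators come from the shorter half twist,
    since moving [gen i] left across [gen_prod k.+1] raises its index by one. *)
Lemma gen_prec_half_twist (i k : nat) : i < k -> k <= n.-1 ->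
  prec (gen i) (half_twist k).
Proof.
elim: k i => // k IH [|i] ik kn.
  suff : prec (gen 0) (gen_prod k.+1).
    by move/prec_trans; apply; apply: prec_mulr.
  elim: k {IH ik kn} => [|k IH]; first by rewrite /= mul1g; apply: prec_refl.
  by apply: prec_trans IH _; apply: prec_mulr.
have [c E] := IH i ik (ltnW kn).
have -> : half_twist k.+1 = gen_prod k.+1 * (gen i * c) by rewrite E.
rewrite mulgA gen_prod_shift //.
by rewrite -mulgA; apply: prec_mulr.
Qed.

(** * The Garside element *)

Definition is_garside D := (forall i, prec (sigma i) D) /\
  forall m, (forall i, prec (sigma i) m) -> prec D m.

(** With the half twist as a common multiple, binary lcms are folded over the generators. *)
Lemma garside_exists : exists D, is_garside D.
Proof.
have [D [_ [Dub Dmin]]] : exists D, prec D (half_twist n.-1) /\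
    ((forall i, i \in enum 'I_n.-1 -> prec (sigma i) D) /\
    forall m, (forall i, i \in enum 'I_n.-1 -> prec (sigma i) m) -> prec D m).
  elim: (enum 'I_n.-1) => [|i s [D [Dt [Dub Dmin]]]].
    exists 1; split; first by exists (half_twist n.-1); rewrite mul1g.
    by split=> // m _; exists m; rewrite mul1g.
  have it : prec (sigma i) (half_twist n.-1).
    by rewrite -gen_ord; apply: gen_prec_half_twist.
  have [E [iE DE Emin]] := ex_lcm it Dt.
  exists E; split; first exact: Emin.
  split=> [j|m mub].
    by rewrite inE => /predU1P[->//|/Dub/prec_trans]; apply.
  apply: Emin; first by apply: mub; rewrite mem_head.
  by apply: Dmin => j js; apply: mub; rewrite inE js orbT.
by exists D; split=> [i|m mub]; [apply: Dub; rewrite mem_enum | apply: Dmin].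
Qed.

Definition garside : braid n := sval (cid garside_exists).

Lemma garsideP : is_garside garside.
Proof. exact: svalP (cid garside_exists). Qed.

Lemma sigma_prec_garside i : prec (sigma i) garside.
Proof. exact: (proj1 garsideP). Qed.

Lemma garside_min m : (forall i, prec (sigma i) m) -> prec garside m.
Proof. exact: (proj2 garsideP). Qed.

Lemma compl_prec_garside i j : prec (compl i j) garside.
Proof.
rewrite /compl; case: eqVneq => [_|ij]; first by exists garside; rewrite mul1g.
case: ifP => [aij|_]; last exact: sigma_prec_garside.
have [x xD] := sigma_prec_garside i.
have := sigma_prec_garside j; rewrite -xD => /prec_sigma_compl[y <-].
rewrite /compl (negPf ij) aij.
have -> : sigma i * (sigma j * sigma i * y) = sigma j * sigma i * (sigma j * y).
  by rewrite -!mulgA sigma_braidA.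
exact: prec_mulr.
Qed.

Lemma garside_prec_sigma i : prec garside (sigma i * garside).
Proof.
by apply: garside_min => j; apply/prec_sigma_compl/compl_prec_garside.
Qed.

(** Write the Garside element as sigma_i x. If sigma_i divided x, so would every other sigma_j, with
    which [compl i j] starts; then the Garside element would divide the shorter x. *)
Lemma sigma_square_garside i : ~ prec (sigma i * sigma i) garside.
Proof.
move=> iiD; have [x xD] := sigma_prec_garside i.
suff /prec_blen : prec garside x by rewrite -xD blenM blen_sigma ltnn.
apply: garside_min => j; have [<-|ij] := eqVneq i j.
  by apply/(prec_mul2l (sigma i)); rewrite xD.
have := sigma_prec_garside j; rewrite -xD => /prec_sigma_compl.
by apply: prec_trans; rewrite /compl (negPf ij); case: ifP => _;
   [apply: prec_mulr | apply: prec_refl].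
Qed.

Lemma resid_prec_garside i b :
  prec b garside -> prec (resid (sigma i) b) garside.
Proof.
move=> bD; apply/(prec_resid _ (sigma_prec_garside i) bD).
exact: prec_trans bD (garside_prec_sigma i).
Qed.

End Lcm.

(** * The language and its automaton *)

Section Language.
Local Open Scope classical_set_scope.
Local Open Scope group_scope.
Variable n : nat.
Implicit Types (i j : 'I_n.-1) (k : nat) (a b c m : braid n) (u v w : word n).

(* [u ++ v] fails to be a lex-representative either because of a letter of [u]
   or because of a letter of [v]; [forb u a] is the first alternative, which
   depends on [v] only through the braid [a] it represents. *)
Fixpoint forb w a : Prop :=
  if w is i :: w' then
    (exists2 j : 'I_n.-1, j < i & prec (sigma j) (braid_of_word w * a)) \/
    forb w' a
  else False.

Lemma forb_cat u v a :
  forb (u ++ v) a <-> forb u (braid_of_word v * a) \/ forb v a.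
Proof.
elim: u => [|i u IH] /=; first by split=> [|[]//]; right.
rewrite IH -cat_cons braid_of_cat -mulgA; tauto.
Qed.

Lemma forb_prec w a b : prec a b -> forb w a -> forb w b.
Proof.
move=> ab; elim: w => //= i w IH [[j ji ja]|/IH]; [left|by right].
by exists j => //; apply: prec_trans ja _; apply/prec_mul2l.
Qed.

(** A word can be improved at its first letter, when a smaller generator divides its braid, or else
    in its tail, by cancellation. *)
Lemma is_lexrepP w : is_lexrep (braid_of_word w) w <-> ~ forb w 1.
Proof.
elim: w => [|i w IH]; first by split=> [_ []|_]; split=> // v.
split=> [[_ wmin] /= [[j ji [c]]|]|nf].
- rewrite mulg1; have [v <-] := braid_wordP c; rewrite -braid_of_cons => vw.
  by have := wmin _ vw; rewrite lexi_cons !leEord leqNgt ji.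
- apply/IH; split=> // v vw; have := wmin (i :: v).
  by rewrite !braid_of_cons vw eqhead_lexiE => /(_ erefl).
split=> // -[|j v] vw.
  by have := congr1 (@blen n) vw; rewrite !blenE.
have ij : i <= j.
  rewrite leqNgt; apply/negP => ji; apply: nf => /=; left; exists j => //.
  by rewrite mulg1 -vw braid_of_cons; apply: prec_mulr.
rewrite lexi_cons !leEord ij /=; apply/implyP => ji.
have E : j = i by apply/val_inj/eqP; rewrite eqn_leq ij ji.
have [_] : is_lexrep (braid_of_word w) w by apply/IH => f; apply: nf; right.
by apply; apply: (@sigma_inj_mul _ i); rewrite -!braid_of_cons -vw E.
Qed.

Lemma is_lexrep_unique a u v : is_lexrep a u -> is_lexrep a v -> u = v.
Proof.
move=> [ua umin] [va vmin].
by apply: (@Order.POrderTheory.le_anti _ (seqlexi 'I_n.-1)); rewrite umin ?vmin.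
Qed.

Lemma lex_languageP w : lex_language n w <-> ~ forb w 1.
Proof.
rewrite -is_lexrepP; split=> [[a _ <-]|lw].
  by have la := omega_spec a; rewrite (proj1 la).
exists (braid_of_word w) => //; apply: is_lexrep_unique lw.
exact: omega_spec.
Qed.

Lemma forbiddenP w a : forbidden w a <-> forb w a.
Proof.
rewrite /forbidden /= lex_languageP notK forb_cat mulg1 (proj1 (omega_spec a)).
split=> [[//|f]|]; last by left.
by have /lex_languageP := imageT (@omega n) a.
Qed.

Lemma lex_language_catl u v : lex_language n (u ++ v) -> lex_language n u.
Proof.
rewrite !lex_languageP forb_cat => nf f; apply: nf; left.
by apply: forb_prec f; exists (braid_of_word v * 1); rewrite mul1g.
Qed.

Lemma forb_seq1 i : ~ forb [:: i] 1.
Proof.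
case=> //= -[j ji]; rewrite braid_of_cons !mulg1 => /prec_sigma[].
  move=> /(congr1 (@blen n)).
  by rewrite blen_sigma blen1.
by move=> /sigma_inj E; rewrite E ltnn in ji.
Qed.

Lemma lex_language_rcons w i :
  lex_language n (rcons w i) <-> ~ forb w (sigma i).
Proof.
rewrite lex_languageP -cats1 forb_cat mulg1.
by have := @forb_seq1 i; tauto.
Qed.

Lemma lex_language_rconsl w i : lex_language n (rcons w i) -> lex_language n w.
Proof. by rewrite -cats1; apply: lex_language_catl. Qed.

(** * Minimal forbidden elements and the transition function *)

Lemma minimal_below (S : set (braid n)) a : S a ->
  exists2 b, minimal S b & prec b a.
Proof.
have [N] := ubnP (blen a); elim: N => // N IH in a *; rewrite ltnS => aN Sa.
have [amin|/existsNP[b /not_implyP[Sb /not_implyP[ba nba]]]] :=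
    pselect (forall b, S b -> prec b a -> b = a).
  by exists a; [split | apply: prec_refl].
have [|//|c cmin cb] := IH b.
  by apply: leq_trans aN; rewrite ltnNge; apply/negP => /(prec_eq ba).
by exists c => //; apply: prec_trans cb ba.
Qed.

(** The hypotheses say that [S] and [T] have the same upward closure, which determines the minimal
    elements. *)
Lemma minimal_sub (S T : set (braid n)) :
  (forall a, S a -> exists2 b, T b & prec b a) ->
  (forall a, T a -> exists2 b, S b & prec b a) ->
  minimal S `<=` minimal T.
Proof.
move=> ST TS a [Sa amin]; have Ta : T a.
  have [b Tb ba] := ST a Sa; have [c Sc cb] := TS b Tb.
  have E := amin c Sc (prec_trans cb ba); rewrite {c}E in Sc cb *.
  by rewrite (prec_antisym cb ba).
split=> // b Tb ba; have [c Sc cb] := TS b Tb.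
have E := amin c Sc (prec_trans cb ba); rewrite {c}E in Sc cb *.
exact: prec_antisym.
Qed.

Lemma eq_minimal (S T : set (braid n)) :
  (forall a, S a -> exists2 b, T b & prec b a) ->
  (forall a, T a -> exists2 b, S b & prec b a) ->
  minimal S = minimal T.
Proof. by move=> ST TS; apply/seteqP; split; apply: minimal_sub. Qed.

Lemma forb_Fmin w a : forb w a <-> exists2 b, Fmin w b & prec b a.
Proof.
split=> [/forbiddenP/minimal_below[b bw ba]|[b [/forbiddenP bw _] ba]].
  by exists b.
exact: forb_prec bw.
Qed.

(** Only 1 lies strictly below an atom, and 1 is not forbidden after a word of the language. *)
Lemma Fmin_sigma w i :
  lex_language n w -> Fmin w (sigma i) <-> forb w (sigma i).
Proof.
move=> /lex_languageP nf; split=> [[/forbiddenP//]|/forb_Fmin[b bw]].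
move=> /prec_sigma[E|<-//]; rewrite {}E in bw.
by case: nf; case: bw => /forbiddenP.
Qed.

(** The recursion behind the transition function: [compl i j] is sigma_(i-1) sigma_i for j = i - 1,
    and sigma_j for smaller j. *)
Lemma forb_rcons w i a : forb (rcons w i) a <->
  forb w (sigma i * a) \/ exists2 j : 'I_n.-1, j < i & prec (compl i j) a.
Proof.
rewrite -cats1 forb_cat /= braid_of_cons mulg1.
split=> [[|[[j ji]|//]]|[|[j ji]]]; [by left| | by left |].
- by move/prec_sigma_compl; right; exists j.
- by move/prec_sigma_compl; right; left; exists j.
Qed.

Lemma Gamma_transE (S T : set (braid n)) i :
  S `<=` [set b | prec b (garside n)] -> ~ S (sigma i) ->
  (forall a, T a <-> (exists2 b, S b & prec b (sigma i * a)) \/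
     exists2 j : 'I_n.-1, j < i & prec (compl i j) a) ->
  minimal T = Gamma_trans S i.
Proof.
move=> SD Si TE; rewrite /Gamma_trans asboolF //; apply: eq_minimal => a.
  move=> /TE[[b Sb bia]|[j ji ja]].
    exists (resid (sigma i) b); first by right; exists b.
    exact/(prec_resid _ (sigma_prec_garside i) (SD b Sb)).
  exists (compl i j) => //; rewrite /compl.
  have -> : (i == j) = false by apply/eqP => E; rewrite E ltnn in ji.
  left; case: ifPn => [aij|nij]; [right|left]; exists j => //=.
    by move: aij; rewrite /adjacent; lia.
  by move: nij; rewrite /adjacent; lia.
move=> Ta; exists a; last exact: prec_refl.
apply/TE; case: Ta => [[[j /= ji <-]|[j /= ji <-]]|[b Sb <-]];
  [right | right | left].
- exists j; first exact: ltnW.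
  have [nE ne] : ~~ adjacent i j /\ i != j.
    by rewrite /adjacent -(inj_eq val_inj) /=; lia.
  by rewrite /compl (negPf ne) (negPf nE); apply: prec_refl.
- exists j; first by rewrite -ji.
  have [nE ne] : adjacent i j /\ i != j.
    by rewrite /adjacent -(inj_eq val_inj) /=; lia.
  by rewrite /compl (negPf ne) nE; apply: prec_refl.
exists b => //.
by apply/(prec_resid _ (sigma_prec_garside i) (SD b Sb)); apply: prec_refl.
Qed.

Lemma Fmin_rcons w i : Fmin w `<=` [set b | prec b (garside n)] ->
  lex_language n (rcons w i) -> Fmin (rcons w i) = Gamma_trans (Fmin w) i.
Proof.
move=> wD lwi; have lw := lex_language_rconsl lwi.
apply: Gamma_transE => // [/(Fmin_sigma i lw)|a].
  by move: lwi => /lex_language_rcons.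
rewrite -forb_Fmin -forb_rcons; exact: forbiddenP.
Qed.

(** Induction along [w]: atoms, products sigma_(i-1) sigma_i and residues of divisors all divide the
    Garside element. *)
Lemma Fmin_prec_garside w : lex_language n w ->
  Fmin w `<=` [set b | prec b (garside n)].
Proof.
elim/last_ind: w => [_|w i IH lwi]; first by rewrite Fmin_nil.
have lw := lex_language_rconsl lwi.
rewrite (Fmin_rcons (IH lw) lwi) /Gamma_trans.
case: asboolP => [_ _ [j _ <-]|_ a [+ _]]; first exact: sigma_prec_garside.
case=> [[[j _ <-]|[j /= ji <-]]|[b /(IH lw) bD <-]].
- exact: sigma_prec_garside.
- have [aij ij] : adjacent i j /\ i != j.
    by rewrite /adjacent -(inj_eq val_inj) /=; lia.
  by have := compl_prec_garside i j; rewrite /compl (negPf ij) aij.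
- exact: resid_prec_garside.
Qed.

(* Otherwise the lcm of sigma_i and some forbidden [b] would be sigma_i^2, which
   would then divide the Garside element. *)
Lemma lex_language_rcons2 w i :
  lex_language n (rcons w i) -> lex_language n (rcons (rcons w i) i).
Proof.
move=> lwi; have lw := lex_language_rconsl lwi.
move: lwi; rewrite !lex_language_rcons forb_rcons => nf [|[j ji]].
  move=> /forb_Fmin[b bw bii]; have bD := Fmin_prec_garside lw bw.
  have [l [[c <-] bl lmin]] := ex_lcm (sigma_prec_garside i) bD.
  have /prec_mul2l/prec_sigma[c1|ci] := lmin _ (prec_mulr _ _) bii.
    by apply: nf; apply/forb_Fmin; exists b => //; move: bl; rewrite c1 mulg1.
  apply: (@sigma_square_garside _ i).
  by rewrite -[in X in _ * X]ci; apply: lmin => //; apply: sigma_prec_garside.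
have /negPf ij : i != j by apply/eqP => E; rewrite E ltnn in ji.
rewrite /compl ij; case: ifP => _ /prec_sigma[] /[dup] /(congr1 (@blen n)).
- by rewrite blenM !blen_sigma blen1.
- by rewrite blenM !blen_sigma.
- by rewrite blen_sigma blen1.
- by move=> _ /sigma_inj E; rewrite E eqxx in ij.
Qed.

(** The sink forbids every letter, but a word of the language can repeat its last letter, and the
    empty word can take any letter. *)
Lemma Fmin_neq_atoms w : 1 < n -> lex_language n w -> Fmin w <> atoms n.
Proof.
move=> n1 lw wA; suff [i lwi] : exists i, lex_language n (rcons w i).
  have : Fmin w (sigma i) by rewrite wA; exists i.
  by move/(Fmin_sigma i lw); apply/lex_language_rcons.
case/lastP: w lw {wA} => [_|w i /lex_language_rcons2]; last by exists i.
have n0 : 0 < n.-1 by case: (n) n1 => [|[]].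
exists (Ordinal n0); apply/lex_languageP; exact: forb_seq1.
Qed.

(** * Runs, finiteness and the accepted language *)

Lemma run_Gamma w : foldl (@Gamma_trans n) set0 w =
  if `[< lex_language n w >] then Fmin w else atoms n.
Proof.
elim/last_ind: w => [|w i IH].
  by rewrite asboolT /= ?Fmin_nil //; apply/lex_languageP.
rewrite foldl_rcons {}IH; case: (asboolP (lex_language n w)) => lw; last first.
  rewrite /Gamma_trans [in LHS]asboolT; last by exists i.
  by rewrite asboolF // => /lex_language_rconsl.
case: (asboolP (lex_language n (rcons w i))) => lwi.
  by rewrite Fmin_rcons //; apply: Fmin_prec_garside.
rewrite /Gamma_trans asboolT //; apply/(Fmin_sigma i lw); apply: contrapT => nf.
exact/lwi/lex_language_rcons.
Qed.

Lemma finite_Gamma_states : finite_set (@Gamma_states n).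
Proof.
rewrite /Gamma_states finite_setU; split; last exact: finite_set1.
pose N := blen (garside n).
(* [Fmin w] consists of divisors of the Garside element, so a finite set of words of length at most
   [N] describes it. *)
pose f (s : {set {bseq N of 'I_n.-1}}) : set (braid n) :=
  [set braid_of_word (t : word n) | t in [set` s]].
apply: (@sub_finite_set _ _ (range f)); last exact/finite_image/finite_finset.
move=> _ [w lw ->]; 
exists [set t : {bseq N of 'I_n.-1} |
          `[< Fmin w (braid_of_word (t : word n)) >]]%SET => //.
apply/seteqP; split=> [_ [t /= + <-]|b bw]; first by rewrite inE => /asboolP.
have := prec_blen (Fmin_prec_garside lw bw).
have [u ub] := braid_wordP b; rewrite -ub blenE => uN.
by exists (Bseq uN) => //=; rewrite inE /= ub; apply/asboolP.
Qed.

Lemma finite_Gamma : is_finite_automaton (Gamma n).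
Proof.
split; [exact: finite_Gamma_states| | by move=> S []|]; last first.
  by left; exists [::]; rewrite ?Fmin_nil //; apply/lex_languageP.
move=> /= S i [[w lw ->]|->]; last first.
  by right; rewrite /Gamma_trans asboolT //; exists i.
have := run_Gamma (rcons w i); rewrite foldl_rcons run_Gamma asboolT // => ->.
by case: asboolP => lwi; [left; exists (rcons w i) | right].
Qed.

Lemma Gamma_language : 1 < n -> accepted_language (Gamma n) = lex_language n.
Proof.
move=> n1; apply/seteqP; split=> w; rewrite /accepted_language /= run_Gamma.
  by case: asboolP => // _ [].
move=> lw; rewrite asboolT //; split; first by left; exists w.
exact: Fmin_neq_atoms.
Qed.

(** * Minimality *)

(** The forbidden sets differ as well; [x] is [omega a] for an [a] in only one of them. *)
Lemma Fmin_distinguish u v : Fmin u <> Fmin v ->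
  exists x, ~ (lex_language n (u ++ x) <-> lex_language n (v ++ x)).
Proof.
move=> uv; apply: contrapT => /forallNP same; apply: uv.
suff : forbidden u = forbidden v by rewrite /Fmin => ->.
apply/seteqP; split=> a fa lw; apply: fa.
  exact/(contrapT (same (omega a))).
exact/(contrapT (same (omega a))).
Qed.

(** The word sigma_2 sigma_1 sigma_2 equals the smaller sigma_1 sigma_2 sigma_1 as a braid. *)
Lemma not_lex_language : 2 < n -> exists w, ~ lex_language n w.
Proof.
move=> n2; have n1 : 1 < n.-1 by case: n n2 => [|[]].
pose i0 := Ordinal (ltnW n1); pose i1 := Ordinal n1.
exists [:: i1; i0; i1] => /lex_languageP; apply; left; exists i0 => //.
rewrite !braid_of_cons (@sigma_braidA _ i1 i0) //.
by rewrite -mulgA; apply: prec_mulr.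
Qed.

(** Send a state of [Gamma n] to the state of [G] reached by a word leading to it. Words that meet
    in [G] have the same continuations in the language, so this map is injective. *)
Lemma Gamma_minimal (T : Type) (G : automaton 'I_n.-1 T) : 2 < n ->
  is_finite_automaton G -> accepted_language G = lex_language n ->
  (states (Gamma n) #<= states G)%card.
Proof.
move=> n2 [_ Gtrans _ Ginit] GL.
have run_state w : states G (foldl (trans G) (init G) w).
  by elim/last_ind: w => // w i IH; rewrite foldl_rcons; apply: Gtrans.
have [w0 nw0] := not_lex_language n2.
have /choice[f fP] : forall S : set (braid n), exists w,
    states (Gamma n) S -> (lex_language n w /\ S = Fmin w) \/
                          (~ lex_language n w /\ S = atoms n).
  move=> S; have [[[w lw ->]|->]|nS] := pselect (states (Gamma n) S).
  - by exists w; left.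
  - by exists w0; right.
  - by exists w0.
pose g S := foldl (trans G) (init G) (f S).
have gL S x : lex_language n (f S ++ x) = accepted G (foldl (trans G) (g S) x).
  by rewrite -GL /accepted_language /= foldl_cat.
suff ginj : set_inj (states (Gamma n)) g.
  have gfun : set_fun (states (Gamma n)) (states G) g.
    by move=> S _; apply: run_state.
  have [h] : $|{injfun states (Gamma n) >-> states G}|.
    by apply/injfunPex; exists g.
  exact: inj_card_le.
move=> S S' /set_mem SG /set_mem S'G gSS'.
have same x : lex_language n (f S ++ x) <-> lex_language n (f S' ++ x).
  by rewrite !gL gSS'.
(* The empty continuation tells the words of the language from those leading to the sink. *)
have := same [::]; rewrite !cats0.
case: (fP S SG) (fP S' S'G) => -[fS SE] [] [fS' SE'] ll.
- rewrite SE SE'; apply: contrapT => /Fmin_distinguish[x]; exact.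
- by case: fS'; apply/ll.
- by case: fS; apply/ll.
- by rewrite SE SE'.
Qed.

End Language.

Local Open Scope card_scope.

Theorem proposition5p2 (n : nat) (n_ge2 : 1 < n) :
  [/\ is_finite_automaton (Gamma n),
      accepted_language (Gamma n) = lex_language n &
      2 < n ->
      forall (T : Type) (G : automaton 'I_n.-1 T),
        is_finite_automaton G ->
        accepted_language G = lex_language n ->
        states (Gamma n) #<= states G].
Proof.
split=> [||n_ge3 T G]; first exact: finite_Gamma.
  exact: Gamma_language.
exact: Gamma_minimal.
Qed.
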